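(* Let $q\ge5$ be a prime power and let $\mathcal{C}_\mathscr{C}$ be the $[q+1,q-3,5]_q$ code with parity check matrix whose columns are the vectors $(1,t,t^2,t^3)$, $t\in\mathbb{F}_q$, and $(0,0,0,1)$. Let $\mathcal{V}^{(3)}$ be a weight-$3$ coset of $\mathcal{C}_\mathscr{C}$. Then $B_0(\mathcal{V}^{(3)})=B_1(\mathcal{V}^{(3)})=B_2(\mathcal{V}^{(3)})=0$, $$B_3(\mathcal{V}^{(3)})\in\begin{cases}\{\frac{q^2-3q+2}{6},\frac{q^2-q}{6}\}& q\equiv1\pmod3,\\ \{\frac{q^2-3q+2}{6},\frac{q^2-q-2}{6},\frac{q^2-q+4}{6}\}& q\equiv-1\pmod3,\\ \{\frac{q^2-3q}{6},\frac{q^2-q}{6}\}& q\equiv0\pmod3,\end{cases}$$ $$B_4(\mathcal{V}^{(3)})=\binom{q+1}{4}-(q-2)B_3(\mathcal{V}^{(3)}),$$ and for $w\ge5$ $$B_w(\mathcal{V}^{(3)})=A_w(\mathcal{C}_\mathscr{C})+(-1)^{w}\left(\binom{q+1}{w}\binom{w-1}{3}-\binom{q-2}{w-3}B_3(\mathcal{V}^{(3)})\right).$$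
   Context: A coset of a linear code $\mathcal{C}\subseteq\mathbb{F}_q^n$ is a set $\mathbf{v}+\mathcal{C}$; its weight is the minimum Hamming weight of its vectors. $B_w(\mathcal{V})$ is the number of vectors of Hamming weight $w$ in the coset $\mathcal{V}$, and $A_w(\mathcal{C}_\mathscr{C})$ is the number of codewords of Hamming weight $w$ in $\mathcal{C}_\mathscr{C}$. *)

(* Defs.v *)
From HB Require Import structures.
From mathcomp Require Import all_boot all_order all_algebra.
Set Implicit Arguments. Unset Strict Implicit. Unset Printing Implicit Defensive.
Import GRing.Theory.
Local Open Scope ring_scope.

(* Coordinates of F_q^{q+1} are indexed by option F:
   Some t  <-> the column (1,t,t^2,t^3), t in F_q;
   None    <-> the column (0,0,0,1). *)
Definition vec (F : finFieldType) := {ffun option F -> F}.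

Definition pcol (F : finFieldType) (i : option F) (r : 'I_4) : F :=
  match i with
  | Some t => t ^+ r
  | None => if r == 3 :> nat then 1 else 0
  end.

Definition codeC (F : finFieldType) : {set vec F} :=
  [set c : vec F | [forall r : 'I_4, \sum_(i : option F) pcol i r * c i == 0]].

Definition hwt (F : finFieldType) (v : vec F) : nat := #|[set i | v i != 0]|.

Definition is_coset (F : finFieldType) (V : {set vec F}) : Prop :=
  exists v : vec F, V = [set v + c | c in codeC F].

Definition coset_weight_is (F : finFieldType) (V : {set vec F}) (w : nat) : Prop :=
  (exists2 x, x \in V & hwt x = w) /\ (forall x, x \in V -> (w <= hwt x)%N).

Definition Bw (F : finFieldType) (V : {set vec F}) (w : nat) : nat :=
  #|[set x in V | hwt x == w]|.
Definition Aw (F : finFieldType) (w : nat) : nat := Bw (codeC F) w.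

(* Main.v *)
Require Import Defs.
From HB Require Import structures.
From mathcomp Require Import all_boot all_order all_algebra.
From mathcomp Require Import all_fingroup all_solvable all_field.
From mathcomp Require Import ring zify.
Set Implicit Arguments.
Unset Strict Implicit.
Unset Printing Implicit Defensive.
Import GRing.Theory.
Local Open Scope ring_scope.

(* A vector x of syndrome s satisfies, for every polynomial p of degree at
   most 3, L p = \sum_P p(P) * x P, where P runs over the projective line,
   p(infinity) is the coefficient of 'X^3, and L is the functional 'X^r |->
   s r. Hence any four columns form a basis, and a set T of three columns
   spans s exactly when L kills the product of the linear factors of T.

   Weights w >= 4. Expanding z^(wt x) = \prod_i (z + (1 - z) [x i = 0])
   writes the weight enumerator of a set of vectors as a sum over coordinate
   sets T of z^|T| (1 - z)^(n - |T|) times the number of vectors supported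
   in T. For |T| >= 4 these numbers agree for the coset and for the code, so
   only |T| <= 3 contributes to the difference of the two enumerators.

   Weight 3. Put phi(P,Q,R) = L(l_P l_Q l_R) with l_P the linear factor of
   P. As s is on no chord, for P <> Q exactly one R satisfies phi(P,Q,R) =
   0; counting ordered triples gives 6 B_3 = (q+1) q - 2 N, where N is the
   number of pairs P <> Q with phi(P,P,Q) = 0. If s is on a tangent, N is
   read off from the cubic form phi(P,P,P), which is then divisible by the
   square of a linear form. Otherwise N = q + 1 - r, with r the number of
   zeros of this cubic form. In characteristic 3 the form is a cube and r =
   1. In other characteristics L kills all multiples of degree at most 3 of
   an irreducible quadratic g; identifying the projective line with K^*/F^*
   for K = F[X]/(g), the zeros become the cube roots of one element of this
   group of order q + 1, so r = 1 if q = 1 mod 3, and r is 0 or 3 if q = 2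
   mod 3. *)

(** * Finite sets, binomial coefficients and characteristic 3 *)

Lemma exists_subset_card (T : finType) (A : {set T}) k :
  (k <= #|A|)%N -> exists2 B : {set T}, B \subset A & #|B| = k.
Proof.
rewrite -bin_gt0 -cards_draws card_gt0 => /set0Pn[B].
by rewrite inE => /andP[sBA /eqP cB]; exists B.
Qed.

Lemma exists_superset_card (T : finType) (A : {set T}) k :
  (#|A| <= k <= #|T|)%N -> exists2 B : {set T}, A \subset B & #|B| = k.
Proof.
move=> /andP[leAk lekT].
have [|B sBA cB] := @exists_subset_card _ (~: A) (k - #|A|).
  by have := cardsC A; lia.
exists (A :|: B); first exact: subsetUl.
rewrite cardsU cB (_ : A :&: B = set0) ?cards0 ?subn0 ?subnKC //.
by apply/eqP; rewrite setI_eq0 disjoint_sym disjoints_subset.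
Qed.

(** Both sides count the chains of a j-set inside a w-set inside an n-set. *)
Lemma mul_bin_sub n j w : (j <= w)%N ->
  ('C(n, j) * 'C(n - j, w - j) = 'C(n, w) * 'C(w, j))%N.
Proof.
move=> le_jw; have [lewn|ltnw] := leqP w n; last first.
  rewrite (bin_small ltnw) mul0n; have [ltnj|lejn] := ltnP n j.
    by rewrite bin_small.
  by rewrite [in X in (_ * X)%N]bin_small ?muln0 // ltn_sub2r //; lia.
have lejn := leq_trans le_jw lewn.
have H1 := bin_fact lejn; have H2 := bin_fact (leq_sub2r j lewn).
have H3 := bin_fact lewn; have H4 := bin_fact le_jw.
have e : (n - j - (w - j) = n - w)%N by lia.
rewrite e in H2.
have g : (0 < j`! * (w - j)`! * (n - w)`!)%N by rewrite !muln_gt0 !fact_gt0.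
apply/eqP; rewrite -(eqn_pmul2r g); apply/eqP.
transitivity n`!; [rewrite -H1 -H2 | rewrite -H3 -H4]; ring.
Qed.

Lemma coef_one_minus_X_exp m k :
  ((1 - 'X) ^+ m : {poly rat})`_k = (-1) ^+ k * 'C(m, k)%:R.
Proof.
rewrite exprBn coef_sum.
under eq_bigr => i _ do rewrite expr1n mulr1 -polyC1 -polyCN -polyC_exp
  -mulrnAr coefCM coefMn coefXn.
have [lekm|ltmk] := leqP k m.
  rewrite (bigD1 (Ordinal (lekm : (k < m.+1)%N))) //= eqxx big1 ?addr0 // => i.
  by rewrite -(inj_eq val_inj) eq_sym /= => /negPf ->; rewrite mul0rn mulr0.
rewrite bin_small // mulr0 big1 // => i _; rewrite gtn_eqF ?mul0rn ?mulr0 //.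
by have := ltn_ord i; lia.
Qed.

(** Lagrange and Cauchy at the prime 3, in the additive group of [F]. *)
Lemma natr3_eq0 (F : finFieldType) : (3%:R == 0 :> F) = (3 %| #|F|)%N.
Proof.
apply/idP/idP => [F3|q3].
  have F3' : 3%N \in [pchar F] by rewrite inE.
  rewrite (dvdn_pcharf F3') -FinRing.zmodXgE -cardsT.
  by rewrite (expg_cardG (in_setT (1 : F))).
have [x x0 x3] : exists2 x : F, x != 0 & x *+ 3 = 0.
  have [|x _ ox] := @Cauchy _ 3 [set: F]%G isT; first by rewrite cardsT.
  exists x; last by rewrite -FinRing.zmodXgE -ox expg_order.
  apply/eqP => x0; have xE : x = 1%g by [].
  by rewrite xE order1 in ox.
by move/eqP: x3; rewrite -[x *+ 3]mulr_natl mulf_eq0 (negPf x0) orbF.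
Qed.

(** * Syndromes, cosets and the functional attached to a syndrome *)

Section Code.

Variable F : finFieldType.
Implicit Types (x y : vec F) (s : {ffun 'I_4 -> F}) (p : {poly F}).
Implicit Types (P Q R : option F) (T : {set option F}).

Definition supp x : {set option F} := [set i | x i != 0].

Lemma notin_supp x T P : supp x \subset T -> P \notin T -> x P = 0.
Proof.
move=> /subsetP sxT; apply: contraNeq => nz; apply: sxT.
by rewrite inE.
Qed.

Definition syndrome x : {ffun 'I_4 -> F} :=
  [ffun r => \sum_(i : option F) pcol i r * x i].

Definition coset_of_syndrome s : {set vec F} := [set x | syndrome x == s].

Lemma syndromeB x y : syndrome (x - y) = syndrome x - syndrome y.
Proof.
apply/ffunP => r; rewrite !ffunE -sumrB; apply: eq_bigr => i _.
by rewrite !ffunE mulrBr.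
Qed.

Lemma syndromeD x y : syndrome (x + y) = syndrome x + syndrome y.
Proof.
apply/ffunP => r; rewrite !ffunE -big_split; apply: eq_bigr => i _.
by rewrite !ffunE mulrDr.
Qed.

Lemma codeCE : codeC F = coset_of_syndrome 0.
Proof.
apply/setP => x; rewrite !inE; apply/forallP/eqP => [x0|x0 r].
  by apply/ffunP => r; rewrite !ffunE; apply/eqP.
by move/ffunP/(_ r): x0; rewrite !ffunE => ->.
Qed.

Lemma is_cosetE (V : {set vec F}) :
  is_coset V -> exists s, V = coset_of_syndrome s.
Proof.
case=> v ->; exists (syndrome v); apply/setP => x; rewrite codeCE !inE.
apply/imsetP/eqP => [[c]|sx].
  by rewrite inE => /eqP c0 ->; rewrite syndromeD c0 addr0.
by exists (x - v); rewrite ?inE ?syndromeB ?sx ?subrr // addrC subrK.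
Qed.

Definition functional s p : F := \sum_(r < 4) s r * p`_r.

Definition evalp p P : F := if P is Some t then p.[t] else p`_3.

Lemma functional_syndrome x p :
  (size p <= 4)%N -> functional (syndrome x) p = \sum_P evalp p P * x P.
Proof.
move=> sz; rewrite /functional.
under eq_bigr do rewrite ffunE mulr_suml.
rewrite exchange_big; apply: eq_bigr => -[t|] _ /=.
  rewrite (horner_coef_wide _ sz) mulr_suml; apply: eq_bigr => r _.
  by rewrite mulrC mulrA.
rewrite !big_ord_recr big_ord0 /= !mul0r !mul1r !add0r.
by rewrite mulrC.
Qed.

(** The linear form vanishing at infinity dehomogenises to 1. *)
Definition linear_factor P : {poly F} := if P is Some t then 'X - t%:P else 1.

Definition vanishing_poly T : {poly F} := \prod_(P in T) linear_factor P.

Lemma linear_factor_monic P : linear_factor P \is monic.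
Proof. by case: P => [t|] /=; rewrite ?monicXsubC ?monic1. Qed.

Lemma vanishing_poly_monic T : vanishing_poly T \is monic.
Proof. by apply: monic_prod => P _; apply: linear_factor_monic. Qed.

Lemma size_vanishing_poly T : size (vanishing_poly T) = #|T :\ None|.+1.
Proof.
have -> : vanishing_poly T = \prod_(P in T :\ None) linear_factor P.
  rewrite /vanishing_poly (big_setID [set None]) /= big1 ?mul1r //.
  by move=> P; rewrite !inE => /andP[_ /eqP ->].
rewrite size_prod => [|P _]; last exact: monic_neq0 (linear_factor_monic P).
rewrite (eq_bigr (fun=> 2%N)); last first.
  by move=> [t|]; rewrite !inE ?eqxx //= size_XsubC.
by rewrite sum_nat_const muln2 -addnn -addnS addKn.
Qed.

Lemma size_vanishing_poly_leq T k :
  (#|T| <= k)%N -> (size (vanishing_poly T) <= k.+1)%N.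
Proof.
rewrite size_vanishing_poly ltnS; apply: leq_trans.
by apply/subset_leq_card/subsetDl.
Qed.

(** As [T] has three points, the degree is 3 exactly when infinity is outside [T], so the
    coefficient of ['X^3] detects infinity as the roots detect the finite points. *)
Lemma evalp_vanishing_poly T P :
  #|T| = 3 -> (evalp (vanishing_poly T) P == 0) = (P \in T).
Proof.
move=> cT; case: P => [t|] /=.
  rewrite horner_prod; apply/idP/idP => [/prodf_eq0[Q TQ]|Tt].
    case: Q TQ => [u|] Tu /=; last by rewrite hornerE oner_eq0.
    by rewrite !hornerE subr_eq0 => /eqP ->.
  by apply/prodf_eq0; exists (Some t); rewrite //= !hornerE subrr.
have sz := size_vanishing_poly T.
have [TN|TN] := boolP (None \in T).
  rewrite nth_default ?eqxx // sz.
  by have := cardsD1 None T; rewrite TN cT add1n => <-.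
have {}sz : size (vanishing_poly T) = 4.
  by have := cardsD1 None T; rewrite (negPf TN) cT add0n sz => <-.
apply/negP => /eqP c0; have := vanishing_poly_monic T.
by rewrite monicE /lead_coef sz c0 eq_sym oner_eq0.
Qed.

(** The cubic vanishes on [T] and [x] vanishes off [P |: T], so only the term at [P] survives. *)
Lemma sum_evalp_vanishing_poly x T P :
    #|T| = 3 -> P \notin T -> supp x \subset P |: T ->
  functional (syndrome x) (vanishing_poly T) = evalp (vanishing_poly T) P * x P.
Proof.
move=> cT TP sx; rewrite functional_syndrome ?size_vanishing_poly_leq ?cT //.
rewrite (bigD1 P) //= big1 ?addr0 // => Q nQP.
have [TQ|TQ] := boolP (Q \in T).
  by move: TQ; rewrite -evalp_vanishing_poly // => /eqP ->; rewrite mul0r.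
by rewrite (notin_supp sx) ?mulr0 // !inE negb_or nQP.
Qed.

Hypothesis F_gt4 : (4 < #|F|)%N.

Lemma card_line_gt4 : (4 < #|{: option F}|)%N.
Proof. by rewrite card_option ltnW. Qed.

(** Any four columns are independent: once [T] is enlarged to four points, the cubic through three
    of them isolates the coordinate of [x] at the fourth. *)
Lemma codeword_small_supp0 x T :
  syndrome x = 0 -> (#|T| <= 4)%N -> supp x \subset T -> x = 0.
Proof.
move=> x0 leT4 sxT.
have [|U sTU cU] := @exists_superset_card _ T 4.
  by rewrite leT4 (ltnW card_line_gt4).
have {sxT sTU} sxU := subset_trans sxT sTU.
apply/ffunP => P; rewrite [RHS]ffunE.
have [UP|/(notin_supp sxU)//] := boolP (P \in U).
have cUP : #|U :\ P| = 3 by have := cardsD1 P U; rewrite UP cU => -[].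
have := @sum_evalp_vanishing_poly x (U :\ P) P cUP.
rewrite setD1K // setD11 x0 => /(_ isT sxU).
rewrite /functional big1 => [/esym/eqP|r _]; last by rewrite ffunE mul0r.
by rewrite mulf_eq0 evalp_vanishing_poly // setD11 => /eqP.
Qed.

Lemma small_supp_inj x y T :
    syndrome x = syndrome y -> (#|T| <= 4)%N ->
    supp x \subset T -> supp y \subset T ->
  x = y.
Proof.
move=> sxy leT4 sx sy; apply/subr0_eq/(@codeword_small_supp0 _ T) => //.
  by rewrite syndromeB sxy subrr.
apply/subsetP => P; rewrite !inE !ffunE; apply: contraR => TP.
by rewrite (notin_supp sx TP) (notin_supp sy TP) subr0.
Qed.

Lemma syndrome_surj s T :
  (4 <= #|T|)%N -> exists2 x, syndrome x = s & supp x \subset T.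
Proof.
move=> /exists_subset_card[U sUT cU].
pose D := [set x : vec F | supp x \subset U].
have cD : #|D| = (#|F| ^ 4)%N.
  rewrite -cU -(card_pffun_on 0 U F); apply: eq_card => x; rewrite inE.
  apply/subsetP/pffun_onP => [sx|[/subsetP sx _] P]; last by rewrite inE => /sx.
  by split=> //; apply/subsetP => P xP; apply: sx; rewrite inE.
(* By independence [syndrome] is injective on [D], which has as many elements as there are
   syndromes. *)
have : syndrome @: D == setT.
  rewrite eqEcard subsetT cardsT card_ffun card_ord card_in_imset ?cD ?leqnn //.
  move=> x y; rewrite !inE => sx sy eq_s; apply: (small_supp_inj eq_s _ sx sy).
  by rewrite cU.
move/eqP/setP/(_ s); rewrite inE => /imsetP[x]; rewrite inE => sx ->.
by exists x => //; apply: subset_trans sUT.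
Qed.

Definition supported (V : {set vec F}) T : {set vec F} :=
  [set x in V | supp x \subset T].

Lemma card_supported_big s T :
  (4 <= #|T|)%N ->
  #|supported (coset_of_syndrome s) T| = #|supported (codeC F) T|.
Proof.
(* Translation by [v] maps the codewords supported in [T] onto the coset vectors supported in
   [T]. *)
move=> /(syndrome_surj s)[v sv vT]; rewrite codeCE.
rewrite -(card_imset (mem (supported (coset_of_syndrome 0) T)) (addrI v)).
apply: eq_card => x; apply/idP/imsetP => [|[y]]; last first.
  rewrite !inE => /andP[/eqP sy yT] ->; rewrite syndromeD sv sy addr0 eqxx /=.
  apply/subsetP => P; rewrite !inE !ffunE; apply: contraR => nTP.
  by rewrite (notin_supp vT nTP) (notin_supp yT nTP) addr0.
rewrite !inE => /andP[/eqP sx xT]; exists (x - v); last by rewrite addrC subrK.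
rewrite !inE syndromeB sx sv subrr eqxx /=.
apply/subsetP => P; rewrite !inE !ffunE; apply: contraR => nTP.
by rewrite (notin_supp xT nTP) (notin_supp vT nTP) subr0.
Qed.

Lemma card_supported_code T : (#|T| <= 4)%N -> #|supported (codeC F) T| = 1%N.
Proof.
move=> cT; apply/eqP/cards1P; exists 0; rewrite codeCE.
have s0 : syndrome (0 : vec F) = 0 by rewrite -(subrr 0) syndromeB subrr.
apply/setP => x; rewrite !inE; apply/andP/eqP => [[/eqP sx xT]|->].
  exact: codeword_small_supp0 xT.
by rewrite s0 eqxx; split=> //; apply/subsetP => P; rewrite inE ffunE eqxx.
Qed.

Lemma card_supported_coset_le1 s T :
  (#|T| <= 4)%N -> (#|supported (coset_of_syndrome s) T| <= 1)%N.
Proof.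
move=> cT; apply/card_le1P => x.
rewrite inE => /andP[]; rewrite inE => /eqP sx xT y.
rewrite !inE; apply/andP/eqP => [[/eqP sy yT]|->]; last by rewrite sx eqxx.
by apply: small_supp_inj cT yT xT; rewrite sx sy.
Qed.

End Code.

(** * Weight enumerators of the coset and of the code *)

Section WeightDistribution.

Variable F : finFieldType.
Implicit Types (x : vec F) (s : {ffun 'I_4 -> F}) (T : {set option F}).
Implicit Types (V : {set vec F}).

Local Notation n := #|F|.+1.

(** A Bernstein polynomial without its binomial factor, for the code length n = q + 1. *)
Definition bernstein j : {poly rat} := 'X^j * (1 - 'X) ^+ (n - j).

Lemma coef_bernstein j w : (j <= w)%N ->
  (bernstein j)`_w = (-1) ^+ (w - j) * 'C(n - j, w - j)%:R.
Proof.
move=> le_jw; rewrite /bernstein coefXnM ltnNge le_jw /=.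
exact: coef_one_minus_X_exp.
Qed.

Lemma expX_hwt x :
  'X^(hwt x) = \sum_(T : {set option F} | supp x \subset T) bernstein #|T|.
Proof.
(* A factor is 1 where [x] is zero and ['X] elsewhere; in the expansion, [T] is the set of indices
   at which the summand ['X] is chosen. *)
have -> : 'X^(hwt x) =
    \prod_(i : option F) ('X + (if x i != 0 then 0 else 1 - 'X)) :> {poly rat}.
  rewrite /hwt -prodr_const [RHS](bigID (mem [set i | x i != 0])) /=.
  rewrite [X in _ = _ * X]big1 ?mulr1; last first.
    by move=> i; rewrite inE => /negPf ->; rewrite addrC subrK.
  by apply: eq_bigr => i; rewrite inE => ->; rewrite addr0.
rewrite bigA_distr [RHS]big_mkcond; apply: eq_bigr => T _.
case: ifPn => [sxT|/subsetPn[i]]; last first.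
  by rewrite inE => xi nTi; rewrite (bigD1 i) //= (negPf nTi) xi mul0r.
rewrite (bigID (mem T)) /=; congr (_ * _).
  by rewrite -prodr_const; apply: eq_bigr => i ->.
have -> : (n - #|T| = #|~: T|)%N.
  by have := cardsC T; rewrite card_option => <-; rewrite addKn.
rewrite -prodr_const; apply: eq_big => i; first by rewrite inE.
move=> /= nTi; rewrite (negPf nTi).
by rewrite (notin_supp sxT nTi) eqxx.
Qed.

Lemma Bw_supported V w :
  (Bw V w)%:R =
  \sum_(T : {set option F}) #|supported V T|%:R * (bernstein #|T|)`_w :> rat.
Proof.
transitivity (\sum_(x in V) 'X^(hwt x) : {poly rat})`_w.
  rewrite coef_sum /Bw -sum1_card natr_sum big_mkcond [RHS]big_mkcond.
  apply: eq_bigr => x _; rewrite inE coefXn eq_sym.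
  by case: (x \in V); case: eqP.
under eq_bigr do rewrite expX_hwt big_mkcond.
rewrite exchange_big coef_sum; apply: eq_bigr => T _.
rewrite -big_mkcondr coef_sum sumr_const [RHS]mulr_natl.
by congr (_ *+ _); apply: eq_card => x; rewrite !inE.
Qed.

Lemma sum_small_subsets (f : nat -> rat) :
  \sum_(T : {set option F} | (#|T| < 4)%N) f #|T| =
  \sum_(j < 4) 'C(n, j)%:R * f j.
Proof.
rewrite (partition_big (fun T => inord #|T| : 'I_4) predT) //=.
apply: eq_bigr => j _.
rewrite (eq_bigl (fun T => T \in [set U : {set option F} | #|U| == j]));
  last first.
  move=> T; rewrite [RHS]inE; apply/andP/eqP => [[T4 /eqP <-]|->].
    by rewrite inordK.
  by rewrite ltn_ord inord_val.
rewrite (eq_bigr (fun=> f j)); last by move=> T; rewrite inE => /eqP ->.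
by rewrite sumr_const card_draws card_option mulr_natl.
Qed.

Hypothesis F_gt4 : (4 < #|F|)%N.

Variable s : {ffun 'I_4 -> F}.
Local Notation V := (coset_of_syndrome s).
Hypothesis V_min3 : forall x, x \in V -> (3 <= hwt x)%N.

Lemma Bw_small w : (w < 3)%N -> Bw V w = 0%N.
Proof.
move=> w3; apply/eqP; rewrite /Bw cards_eq0; apply/eqP/setP => x.
rewrite inE [RHS]inE.
by apply/andP => -[/V_min3 h3 /eqP hw]; rewrite hw leqNgt w3 in h3.
Qed.

Lemma supported_lt3 T : (#|T| < 3)%N -> #|supported V T| = 0%N.
Proof.
move=> T3; apply/eqP; rewrite cards_eq0; apply/eqP/setP => x.
rewrite inE [RHS]inE.
apply/andP => -[/V_min3 h3 /subset_leq_card]; rewrite -/(hwt x) => hT.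
by have := leq_ltn_trans (leq_trans h3 hT) T3.
Qed.

Lemma Bw3_supported :
  Bw V 3 = (\sum_(T : {set option F} | #|T| == 3%N) #|supported V T|)%N.
Proof.
rewrite /Bw -sum1_card (partition_big (@supp F) (fun T => #|T| == 3%N));
  last first.
  by move=> x; rewrite inE => /andP[].
apply: eq_bigr => T /eqP T3; rewrite sum1_card; apply: eq_card => x.
rewrite unfold_in /= !inE; apply/andP/andP.
  by case=> /andP[sx hx] /eqP <-.
case=> sx xT.
have : supp x == T.
  by rewrite eqEcard xT T3; apply: V_min3; rewrite inE.
by move=> eT; rewrite sx eT /hwt -/(supp x) (eqP eT) T3.
Qed.

(** For |T| >= 4 the two counts cancel. For |T| <= 3 the code has only the zero word, and for |T| <
    3 the coset has nothing. *)
Lemma card_supported_sub T :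
  #|supported V T|%:R - #|supported (codeC F) T|%:R =
  (if #|T| == 3%N then #|supported V T|%:R else 0)
  - (if (#|T| < 4)%N then 1 else 0)
  :> rat.
Proof.
case: ifPn => [/eqP T3|T3].
  by rewrite T3 card_supported_code ?T3.
case: ifPn => T4; last by rewrite card_supported_big ?subrr // leqNgt.
by rewrite supported_lt3 ?card_supported_code //; lia.
Qed.

Lemma Bw_sub_Aw w :
  (Bw V w)%:R - (Aw F w)%:R =
  (Bw V 3)%:R * (bernstein 3)`_w - \sum_(j < 4) 'C(n, j)%:R * (bernstein j)`_w
  :> rat.
Proof.
rewrite /Aw Bw3_supported !Bw_supported -sumrB.
under eq_bigr do rewrite -mulrBl card_supported_sub mulrBl.
rewrite sumrB -(sum_small_subsets (fun j => (bernstein j)`_w)).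
rewrite natr_sum mulr_suml !(big_mkcond (fun T => #|T| == 3%N)).
rewrite [in RHS](big_mkcond (fun T => (#|T| < 4)%N)).
congr (_ - _); apply: eq_bigr => T _; last by case: ifP; rewrite ?mul1r ?mul0r.
by case: eqP => [->|]; rewrite ?mul0r.
Qed.

Lemma Bw_ge4 w : (4 <= w)%N ->
  (Bw V w)%:R = (Aw F w)%:R + (-1) ^+ w *
    (('C(n, w) * 'C(w.-1, 3))%:R - 'C(#|F| - 2, w - 3)%:R * (Bw V 3)%:R) :> rat.
Proof.
case: w => [|[|[|[|w]]]] // _; apply/eqP; rewrite addrC -subr_eq; apply/eqP.
have coefE j : (j <= w.+4)%N -> 'C(n, j)%:R * (bernstein j)`_w.+4 =
    (-1) ^+ (w.+4 - j) * ('C(n, w.+4) * 'C(w.+4, j))%:R.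
  by move=> le_jw; rewrite coef_bernstein // mulrCA -natrM mul_bin_sub.
(* What remains is the partial alternating sum of (-1)^j C(w, j) over j < 4, equal to - C(w - 1, 3)
   by Pascal's rule. *)
rewrite Bw_sub_Aw !big_ord_recr big_ord0 /= add0r !coefE // coef_bernstein //.
rewrite !subSS !subn0 natrM !(binS w.+3) !bin0 !exprS !natrM !natrD; ring.
Qed.

Lemma Aw4 : Aw F 4 = 0%N.
Proof.
apply/eqP; rewrite /Aw /Bw cards_eq0; apply/eqP/setP => x; rewrite inE [RHS]inE.
apply/andP => -[]; rewrite codeCE inE => /eqP sx /eqP hx.
have x0 : x = 0.
  apply: (codeword_small_supp0 F_gt4 sx (T := supp x)) => //.
  by rewrite -[#|_|]/(hwt x) hx.
have : (0 < hwt x)%N by rewrite hx.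
by rewrite card_gt0 => /set0Pn[P]; rewrite inE x0 ffunE eqxx.
Qed.

End WeightDistribution.

(** * The symmetric trilinear form and its zeros *)

Section Functional.

Variables (F : finFieldType) (s : {ffun 'I_4 -> F}).
Implicit Types (g p : {poly F}) (P Q R : option F) (T : {set option F}).

Local Notation L := (functional s).

Lemma functionalD p g : L (p + g) = L p + L g.
Proof. by rewrite -big_split; apply: eq_bigr => r _; rewrite coefD mulrDr. Qed.

Lemma functionalCM c p : L (c%:P * p) = c * L p.
Proof.
by rewrite /functional mulr_sumr; apply: eq_bigr => r _; rewrite coefCM mulrCA.
Qed.

Lemma functional_linear_factor g P :
  L (g * linear_factor P) =
  if P is Some t then L (g * 'X) - t * L g else L g.
Proof.
case: P => [t|] /=; last by rewrite mulr1.
by rewrite mulrBr functionalD -mulrN -polyCN [g * _%:P]mulrC functionalCM mulNr.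
Qed.

Definition trilinear P Q R : F :=
  L (linear_factor P * linear_factor Q * linear_factor R).

Lemma trilinearCA P Q R : trilinear P Q R = trilinear Q P R.
Proof. by rewrite /trilinear [linear_factor P * _]mulrC. Qed.

Lemma trilinearAC P Q R : trilinear P Q R = trilinear P R Q.
Proof. by rewrite /trilinear mulrAC. Qed.

(* The line joining P and Q (the tangent at P when P = Q) contains s. *)
Definition on_line P Q : bool :=
  let g := linear_factor P * linear_factor Q in
  (L g == 0) && (L (g * 'X) == 0).

Lemma on_line_trilinear0 P Q R : on_line P Q -> trilinear P Q R = 0.
Proof.
case/andP => /eqP g0 /eqP gX0; rewrite /trilinear functional_linear_factor.
by case: R => [t|]; rewrite ?gX0 g0 ?mulr0 ?subr0.
Qed.

(** In [R] this is a linear form on the projective line with coefficients [L g] and [L (g * 'X)].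
    They are not both zero, so it has one zero: infinity if [L g] is 0, their quotient otherwise. *)
Lemma card_trilinear0 P Q :
  ~~ on_line P Q -> #|[set R | trilinear P Q R == 0]| = 1%N.
Proof.
rewrite /on_line; set g := _ * _ => nPQ; apply/eqP/cards1P.
have [g0|g0] := eqVneq (L g) 0.
  rewrite g0 eqxx /= in nPQ; exists None; apply/setP => R.
  rewrite !inE /trilinear functional_linear_factor -/g g0.
  by case: R => [t|]; rewrite ?mulr0 ?subr0 ?eqxx ?(negPf nPQ).
exists (Some (L (g * 'X) / L g)); apply/setP => R.
rewrite !inE /trilinear functional_linear_factor -/g.
case: R => [t|]; rewrite ?(negPf g0) //.
rewrite subr_eq0; apply/eqP/eqP => [->|[->]]; first by rewrite mulfK.
by rewrite mulfVK.
Qed.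

Lemma trilinear0_unique P Q R R' :
    ~~ on_line P Q -> trilinear P Q R = 0 -> trilinear P Q R' = 0 ->
  R = R'.
Proof.
move=> /card_trilinear0/eqP/cards1P[R0 eR] h h'.
have : R \in [set R0] by rewrite -eR inE h.
have : R' \in [set R0] by rewrite -eR inE h'.
by rewrite !inE => /eqP -> /eqP ->.
Qed.

Lemma vanishing_poly3 T P Q :
    #|T| = 3 -> P \in T -> Q \in T -> Q != P ->
  exists2 R, [/\ R != P, R != Q & T = R |: [set P; Q]] &
    vanishing_poly T = linear_factor P * linear_factor Q * linear_factor R.
Proof.
move=> cT TP TQ nQP.
have TQP : Q \in T :\ P by rewrite !inE nQP.
have /eqP/cards1P[R eR] : #|T :\ P :\ Q| = 1%N.
  by have := cardsD1 P T; rewrite TP cT (cardsD1 Q) TQP => -[].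
have : R \in T :\ P :\ Q by rewrite eR set11.
rewrite !inE => /and3P[nRQ nRP TR]; exists R.
  split=> //; apply/setP => S; have /setP/(_ S) := eR; rewrite !inE.
  have [->|_] := eqVneq S P; first by rewrite TP orbT.
  by have [->|_] := eqVneq S Q; [rewrite TQ !orbT | rewrite !orbF].
rewrite /vanishing_poly (big_setD1 P) //= (big_setD1 Q) //= eR big_set1.
by rewrite mulrA.
Qed.

End Functional.

(** * Counting B_3 by ordered triples of points *)

Section Triples.

Variables (F : finFieldType) (s : {ffun 'I_4 -> F}).
Implicit Types (P Q R : option F) (T : {set option F}).
Local Notation V := (coset_of_syndrome s).
Local Notation phi := (trilinear s).
Hypothesis F_gt4 : (4 < #|F|)%N.
Hypothesis V_min3 : forall x, x \in V -> (3 <= hwt x)%N.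

(** For a fourth point [P] and the vector [x] of syndrome [s] supported in [P |: T], the functional
    at the cubic of [T] is a nonzero multiple of [x P]; it vanishes exactly when [x] is supported in
    [T]. *)
Lemma card_supported3 T :
  #|T| = 3 -> #|supported V T| = (functional s (vanishing_poly T) == 0).
Proof.
move=> cT; have [P TP] : exists P, P \notin T.
  have /set0Pn[P] : ~: T != set0.
    by rewrite -card_gt0 -(ltn_add2l #|T|) addn0 cardsC cT ltnW ?card_line_gt4.
  by rewrite inE; exists P.
have [|x sx xT] := syndrome_surj F_gt4 s (T := P |: T).
  by rewrite cardsU1 TP cT.
have eq_s := sum_evalp_vanishing_poly cT TP xT; rewrite sx in eq_s.
have := card_supported_coset_le1 F_gt4 s (T := T); rewrite cT => /(_ isT).
case: eqP => [s0|s0].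
  move=> le1; apply/eqP; rewrite eqn_leq le1 card_gt0; apply/set0Pn; exists x.
  move/eqP: eq_s; rewrite s0 eq_sym mulf_eq0 evalp_vanishing_poly //.
  rewrite (negPf TP) /=.
  move=> xP; rewrite !inE sx eqxx /=; apply/subsetP => Q xQ.
  have := subsetP xT Q xQ; rewrite !inE => /orP[/eqP QP|//].
  by rewrite inE QP xP in xQ.
move=> _; apply/eqP; rewrite cards_eq0; apply/eqP/setP => y; rewrite !inE.
apply/negP => /andP[/eqP sy yT]; case: s0.
rewrite -sy (sum_evalp_vanishing_poly cT TP) ?(subset_trans yT) ?subsetUr //.
by rewrite (notin_supp yT TP) mulr0.
Qed.

(** Suppose [s] is on the chord and let [x] have syndrome [s] and support in a 4-set [U] containing
    [P] and [Q]. For any other [R] in [U], the cubic of [U :\ R] has the factors of [P] and [Q], so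
    L kills it and [x R = 0]. Then [x] has weight at most 2. *)
Lemma chord_avoids P Q : Q != P -> ~~ on_line s P Q.
Proof.
move=> nQP; apply/negP => PQ.
have [|U sU cU] := @exists_superset_card _ [set P; Q] 4.
  by rewrite cards2 (ltnW (card_line_gt4 F_gt4)) andbT; case: (_ != _).
have [|x sx xU] := syndrome_surj F_gt4 s (T := U); first by rewrite cU.
have UP : P \in U by apply: (subsetP sU); rewrite !inE eqxx.
have UQ : Q \in U by apply: (subsetP sU); rewrite !inE eqxx orbT.
have /V_min3 : x \in V by rewrite inE sx.
apply/negP; rewrite -ltnNge ltnS.
apply: (@leq_trans #|[set P; Q]|); last by rewrite cards2; case: (_ != _).
apply/subset_leq_card/subsetP => R xR; apply: contraTT (xR) => nR.
rewrite !inE negb_or in nR; case/andP: nR => nRP nRQ.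
have UR : R \in U by apply: (subsetP xU).
have cR : #|U :\ R| = 3 by have := cardsD1 R U; rewrite UR cU => -[].
have [||R' _ eR'] := vanishing_poly3 cR _ _ nQP.
- by rewrite !inE eq_sym nRP.
- by rewrite !inE eq_sym nRQ.
have := @sum_evalp_vanishing_poly _ x (U :\ R) R cR.
rewrite setD11 setD1K // sx eR' => /(_ isT xU).
rewrite -/(trilinear s P Q R') on_line_trilinear0 // => /esym/eqP.
by rewrite mulf_eq0 -eR' evalp_vanishing_poly // setD11 /= inE negbK.
Qed.

(** A weight-3 vector of the coset is determined by its support, which has 6 orderings. *)
Lemma Bw3_triples :
  (6 * Bw V 3 = \sum_P \sum_(Q | Q != P)
     #|[set R | [&& R != P, R != Q & phi P Q R == 0%R]]|)%N.
Proof.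
pose G := [set T : {set option F} |
  (#|T| == 3%N) && (functional s (vanishing_poly T) == 0)].
have -> : Bw V 3 = #|G|.
  rewrite Bw3_supported // -sum1_card [RHS]big_mkcond [LHS]big_mkcond.
  apply: eq_bigr => T _; rewrite inE; case: eqP => //= cT.
  by rewrite card_supported3 //; case: (_ == _).
transitivity (\sum_(T in G) \sum_(P in T) \sum_(Q in T :\ P) 1)%N.
  rewrite mulnC -sum_nat_const; apply: eq_bigr => T.
  rewrite inE => /andP[/eqP cT _].
  rewrite (eq_bigr (fun=> 2%N)) ?sum_nat_const ?cT // => P TP.
  by rewrite sum1_card; have := cardsD1 P T; rewrite TP cT => -[].
rewrite (exchange_big_dep predT) //=; apply: eq_bigr => P _.
rewrite (exchange_big_dep (fun Q => Q != P)) /=; last first.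
  by move=> T Q _; rewrite !inE => /andP[].
apply: eq_bigr => Q nQP; rewrite sum1_card.
rewrite -(card_in_imset (f := fun R => R |: [set P; Q])) => [|R R']; last first.
  rewrite !inE => /and3P[RP RQ _] /and3P[R'P R'Q _] /setP/(_ R).
  by rewrite !inE eqxx (negPf RP) (negPf RQ) !orbF => /esym/eqP.
apply: eq_card => T; rewrite unfold_in /= !inE.
apply/idP/imsetP => [/andP[/andP[/andP[/eqP cT s0] TP] /andP[_ TQ]]|[R]].
  have [R [nRP nRQ eT] eR] := vanishing_poly3 cT TP TQ nQP.
  by exists R => //; rewrite !inE nRP nRQ /trilinear -eR.
rewrite !inE => /and3P[nRP nRQ s0 ->].
have nPQ : P != Q by rewrite eq_sym.
apply/andP; split; last by apply/andP; split; rewrite ?inE ?eqxx ?orbT.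
apply/andP; split; last by rewrite !inE eqxx orbT.
apply/andP; split; first by rewrite cardsU1 !inE negb_or nRP nRQ cards2 nPQ.
have -> : vanishing_poly (R |: [set P; Q]) =
    linear_factor P * linear_factor Q * linear_factor R.
  rewrite /vanishing_poly big_setU1 ?inE ?negb_or ?nRP //=.
  by rewrite big_setU1 ?inE // big_set1 mulrC.
by [].
Qed.

(** The number of [Q != P] with [phi P P Q = 0]: all q of them if the tangent contains [s],
    otherwise the single zero of [phi P P] unless this is [P] itself. *)
Definition tangent_count P : nat :=
  if on_line s P P then #|F| else (phi P P P != 0).

Lemma sum_tangent_pairs P :
  (\sum_(Q | Q != P) (phi P P Q == 0%R) = tangent_count P)%N.
Proof.
rewrite /tangent_count; case: ifPn => [tP|ntP].
  rewrite (eq_bigr (fun=> 1%N)) => [|Q _].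
    by rewrite sum1_card (eq_card (B := mem (predC1 P))) // cardC1 card_option.
  by rewrite on_line_trilinear0 ?eqxx.
have c1 := card_trilinear0 ntP; have [P0|nP0] := eqVneq (phi P P P) 0.
  apply: big1 => Q nQP; apply/eqP; rewrite eqb0; apply: contra nQP => /eqP Q0.
  by apply/eqP/(trilinear0_unique ntP).
rewrite -[RHS]c1 -sum1_card big_mkcond [RHS]big_mkcond.
apply: eq_bigr => Q _; rewrite inE.
by case: eqP => [->|_]; [rewrite (negPf nP0) | case: (_ == _)].
Qed.

(** Each of the (q + 1) q ordered pairs has one third point R. Pairs with R distinct from both give
    6 B_3; the cases R = P and R = Q each give the sum of [tangent_count]. *)
Lemma Bw3_tangents :
  (6 * Bw V 3 + 2 * \sum_P tangent_count P = #|F|.+1 * #|F|)%N.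
Proof.
have sumE1 : (\sum_P tangent_count P =
    \sum_P \sum_(Q | Q != P) (phi P P Q == 0%R))%N.
  by apply: eq_bigr => P _; rewrite sum_tangent_pairs.
(* The same count with the two points exchanged, for the case R = Q. *)
have sumE2 : (\sum_P tangent_count P =
    \sum_P \sum_(Q | Q != P) (phi Q Q P == 0%R))%N.
  rewrite (exchange_big_dep predT) //=; apply: eq_bigr => P _.
  by rewrite -sum_tangent_pairs; apply: eq_bigl => Q; rewrite eq_sym.
rewrite Bw3_triples mul2n -addnn {1}sumE1 sumE2 -!big_split /=.
rewrite (eq_bigr (fun=> #|F|)) ?sum_nat_const ?card_option // => P _.
rewrite -!big_split /= (eq_bigr (fun=> 1%N)) => [|Q nQP].
  by rewrite sum1_card (eq_card (B := mem (predC1 P))) // cardC1 card_option.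
rewrite -(card_trilinear0 (chord_avoids nQP)) (cardsD1 P) (cardsD1 Q (_ :\ P)).
rewrite !inE nQP /= [phi P Q Q]trilinearCA [phi Q P Q]trilinearAC.
rewrite [phi P Q P]trilinearAC addnC -addnA; congr (_ + (_ + _))%N.
by apply: eq_card => R; rewrite !inE andbCA.
Qed.

End Triples.

(** * Cube roots in K^*/F^* for a quadratic extension K of F *)

Section QuadraticExtension.

Variables (F K : finFieldType) (iota : {rmorphism F -> K}) (theta : K).
Hypothesis theta_gen : forall y, exists a b, y = iota a + iota b * theta.
Hypothesis theta_free :
  forall a b, iota a + iota b * theta = 0 -> a = 0 /\ b = 0.
Hypothesis card_K : #|K| = (#|F| ^ 2)%N.
Implicit Types (P Q : option F) (y z : K).

Local Notation q := #|F|.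

(** One representative for each class of K^*/F^*. *)
Definition line_point P : K := if P is Some t then theta - iota t else 1.

Lemma line_point_neq0 P : line_point P != 0.
Proof.
case: P => [t|] /=; last exact: oner_neq0.
apply/eqP => e; have [|_ /eqP] := @theta_free (- t) 1; last by rewrite oner_eq0.
by rewrite rmorphN rmorph1 mul1r addrC.
Qed.

Lemma line_point_exists y :
  y != 0 -> exists P k, y = iota k * line_point P.
Proof.
have [a [b ->]] := theta_gen y; have [->|b0] := eqVneq b 0.
  by exists None, a; rewrite rmorph0 mul0r addr0 mulr1.
move=> _; exists (Some (- a / b)), b => /=.
by rewrite mulrBr -rmorphM mulrCA divff // mulr1 rmorphN opprK addrC.
Qed.

Lemma line_point_inj P Q k : line_point P = iota k * line_point Q -> P = Q.
Proof.
case: P Q => [t|] [u|] //= e.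
- have [|] := @theta_free (k * u - t) (1 - k).
    rewrite !(rmorphB, rmorphM, rmorph1) mulrBl mul1r.
    have -> : theta = theta - iota t + iota t by rewrite subrK.
    rewrite [X in _ + (X + _ - _)]e; ring.
  move=> tu /subr0_eq k1; move/subr0_eq: tu; rewrite -k1 mul1r => ->.
  by [].
- have [|_ /eqP] := @theta_free (- t - k) 1; last by rewrite oner_eq0.
  rewrite rmorphB rmorphN rmorph1 mul1r.
  by rewrite addrC addrA e mulr1 subrr.
- have [|/eqP] := @theta_free (- k * u - 1) k; last first.
    by move=> + k0; rewrite k0 oppr0 mul0r sub0r oppr_eq0 oner_eq0.
  rewrite rmorphB rmorphM rmorphN rmorph1 [X in _ - X]e; ring.
Qed.

Lemma iotaP z : z ^+ q = z -> exists a, z = iota a.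
Proof.
move=> zq.
have /(congr1 (fun p => (map_poly iota p).[z])) := finField_genPoly F.
rewrite rmorphB rmorph_prod rmorphXn /= map_polyX !hornerE zq subrr horner_prod.
move/esym/eqP/prodf_eq0 => [a _].
rewrite map_polyXsubC !hornerE subr_eq0 => /eqP ->.
by exists a.
Qed.

Lemma normP y : exists k, y ^+ q.+1 = iota k.
Proof.
apply: iotaP; rewrite -exprM mulSn addnC exprD mulnn -card_K expf_card.
by rewrite -exprS.
Qed.

(** For nonzero [d]: the class of [P] in K^*/F^* is a cube root of the class of [d]. *)
Definition cube_on d P := exists k, line_point P ^+ 3 = iota k * d.

Lemma cube_on_unique d :
  d != 0 -> (q %% 3 = 1)%N -> exists P0, forall P, cube_on d P <-> P = P0.
Proof.
(* As 3 e = q + 2, the exponent e inverts 3 modulo the group order q + 1; the only cube root is the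
   class of [d ^+ e]. *)
move=> d0 q1; pose e := ((q + 2) %/ 3)%N.
have e3 : (3 * e = q.+2)%N by rewrite /e; lia.
have [|P0 [k ek]] := @line_point_exists (d ^+ e); first by rewrite expf_neq0.
have k0 : iota k != 0.
  by apply: contraNneq (expf_neq0 e d0) => k0; rewrite ek k0 mul0r.
exists P0 => P; split=> [[l el]|->].
  have [m em] := normP (line_point P).
  have l0 : iota l ^+ e * iota k != 0.
    have := expf_neq0 3 (line_point_neq0 P).
    rewrite el mulf_eq0 negb_or => /andP[l0 _].
    by rewrite mulf_neq0 ?expf_neq0.
  have : iota m * line_point P = iota l ^+ e * iota k * line_point P0.
    by rewrite -em -exprSr -e3 exprM el exprMn ek mulrA.
  move=> eP; have m0 : m != 0.
    apply: contraNneq (mulf_neq0 l0 (line_point_neq0 P0)) => m0.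
    by rewrite -eP m0 rmorph0 mul0r.
  apply: (@line_point_inj _ _ (l ^+ e * k / m)).
  rewrite fmorph_div rmorphM rmorphXn mulrAC -eP mulrAC divff ?mul1r //.
  by rewrite fmorph_eq0.
have [m em] := normP d; exists (m / k ^+ 3).
rewrite fmorph_div rmorphXn mulrAC -em -exprSr -e3 mulnC exprM ek exprMn.
by rewrite mulrAC divff ?mul1r // expf_neq0.
Qed.

(** 3 divides the order q^2 - 1 of K^* but not the order q - 1 of F^*. *)
Lemma primitive_cube_root :
  (q %% 3 = 2)%N -> exists2 w, w ^+ 2 + w + 1 = 0 & forall a, w <> iota a.
Proof.
move=> q2.
have [|w _ ow] := @Cauchy _ 3 [set: {unit K}]%G isT.
  rewrite card_finField_unit card_K; apply/eqP; nia.
have w3 : val w ^+ 3 = 1.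
  by rewrite -FinRing.val_unitX -ow expg_order.
have w1 : val w != 1.
  apply/eqP => w1; have wE : w = 1%g by apply: val_inj.
  by rewrite wE order1 in ow.
have w_eq0 : val w ^+ 2 + val w + 1 = 0.
  apply/(mulfI (x := val w - 1)); first by rewrite subr_eq0.
  by rewrite mulr0; transitivity (val w ^+ 3 - 1); [ring | rewrite w3 subrr].
exists (val w) => // a wa; case/eqP: w1.
have a3 : a ^+ 3 = 1.
  by apply: (fmorph_inj iota); rewrite rmorphXn -wa w3 rmorph1.
have : a ^+ q = a by apply: expf_card.
rewrite (divn_eq q 3) q2 exprD mulnC exprM a3 expr1n mul1r => a2.
have a0 : a != 0 by rewrite -(fmorph_eq0 iota) -wa -unitfE (valP w).
have -> : val w = iota 1; last by rewrite rmorph1.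
by rewrite wa; congr (iota _); apply/(mulfI a0); rewrite -expr2 mulr1.
Qed.

Lemma cube_root_in_base (a : F) :
  (q %% 3 = 2)%N -> exists b, b ^+ 3 = a.
Proof.
move=> q2; have [->|a0] := eqVneq a 0; first by exists 0; rewrite expr0n.
(* Three times this exponent is 2 q - 1, and a^(2 q) = a^2. *)
exists (a ^+ (q %/ 3).*2.+1); apply/(mulfI a0).
rewrite -exprM -exprS (_ : _.+1 = q * 2)%N ?exprM ?expf_card ?expr2 //.
by rewrite -muln2; lia.
Qed.

(** Cube roots of one class differ by a cube root of unity of K^*/F^*, and these are the classes of
    1, w and w^2. *)
Lemma cube_on_three d P0 :
    d != 0 -> (q %% 3 = 2)%N -> cube_on d P0 ->
  exists P1 P2, uniq [:: P0; P1; P2] /\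
    forall P, cube_on d P <-> P \in [:: P0; P1; P2].
Proof.
move=> d0 q2 [k0 ek0]; have [w w0 nw] := primitive_cube_root q2.
have w3 : w ^+ 3 = 1.
  by apply/subr0_eq; rewrite -[RHS](mulr0 (w - 1)) -w0; ring.
have wn0 : w != 0.
  by apply: contra_eq_neq w0 => ->; rewrite expr0n !add0r oner_neq0.
set y0 := line_point P0; have y0n0 : y0 != 0 := line_point_neq0 P0.
have k0n0 : k0 != 0.
  apply: contraNneq (expf_neq0 3 y0n0) => k00.
  by rewrite ek0 k00 rmorph0 mul0r.
have [|P1 [k1 ek1]] := @line_point_exists (y0 * w); first exact: mulf_neq0.
have [|P2 [k2 ek2]] := @line_point_exists (y0 * w ^+ 2).
  by rewrite mulf_neq0 ?expf_neq0.
have k1n0 : iota k1 != 0.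
  by apply: contraNneq (mulf_neq0 y0n0 wn0) => k10; rewrite ek1 k10 mul0r.
have k2n0 : iota k2 != 0.
  apply: contraNneq (mulf_neq0 y0n0 (expf_neq0 2 wn0)) => k20.
  by rewrite ek2 k20 mul0r.
have eP1 : line_point P1 = y0 * w / iota k1 by rewrite ek1 mulrAC divff ?mul1r.
have eP2 : line_point P2 = y0 * w ^+ 2 / iota k2.
  by rewrite ek2 mulrAC divff ?mul1r.
exists P1, P2; split.
  (* A coincidence would put w into F: as k1, as k2^2 = w^4, or as k2 / k1. *)
  rewrite /= !inE !negb_or -!andbA andbT; apply/and3P; split; apply/eqP => e.
  - apply: (nw k1); apply: (mulfI y0n0).
    by rewrite ek1 -e mulrC.
  - apply: (nw (k2 ^+ 2)); rewrite rmorphXn; apply: (mulfI (expf_neq0 2 y0n0)).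
    rewrite -exprMn (_ : y0 * iota k2 = y0 * w ^+ 2); last first.
      by rewrite ek2 -e mulrC.
    by rewrite exprMn -exprM (exprD _ 3 1) w3 mul1r.
  - apply: (nw (k2 / k1)); apply: (mulfI y0n0); apply: (mulIf wn0).
    by rewrite -mulrA -expr2 ek2 -e eP1 fmorph_div; field.
have cube k w' P :
    w' ^+ 3 = 1 -> line_point P = y0 * w' / iota k -> cube_on d P.
  move=> w'3 eP; exists (k0 / k ^+ 3).
  by rewrite eP !exprMn w'3 ek0 fmorph_div rmorphXn exprVn mulr1 mulrAC.
move=> P; split=> [[k ek]|].
  (* Rescaling [y0] by [b] turns equality of classes into equality of cubes in K; the difference of
     the cubes then splits into linear factors because w^2 + w + 1 = 0. *)
  have [b b3] := cube_root_in_base (k / k0) q2.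
  have eb : line_point P ^+ 3 = (iota b * y0) ^+ 3.
    by rewrite exprMn -rmorphXn b3 fmorph_div ek0 ek mulrA divfK ?fmorph_eq0.
  have : (line_point P - iota b * y0) * (line_point P - iota b * (y0 * w))
      * (line_point P - iota b * (y0 * w ^+ 2)) == 0.
    apply/eqP; transitivity ((line_point P ^+ 3 - (iota b * y0) ^+ 3)
      + (w ^+ 2 + w + 1) * (iota b * y0) * (- line_point P ^+ 2
         + line_point P * w * iota b * y0 - (iota b * y0) ^+ 2 * (w - 1))).
      ring.
    by rewrite eb w0 subrr !mul0r addr0.
  rewrite !mulf_eq0 !subr_eq0 !inE ek1 ek2 !mulrA -!rmorphM.
  by case/orP => [/orP[]|] /eqP/line_point_inj ->; rewrite eqxx ?orbT.
rewrite !inE => /or3P[] /eqP ->; first by exists k0.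
  exact: cube w3 eP1.
by apply: cube eP2; rewrite -exprM mulnC exprM w3 expr1n.
Qed.

End QuadraticExtension.

(** A quadratic without roots is irreducible; K is its quotient ring and [theta] the class of
    ['X]. *)
Lemma quadratic_extension (F : finFieldType) (b c : F) :
    (forall t, t ^+ 2 + b * t + c != 0) ->
  exists (K : finFieldType) (iota : {rmorphism F -> K}) (theta : K),
    [/\ theta ^+ 2 + iota b * theta + iota c = 0,
        forall y, exists u v, y = iota u + iota v * theta,
        forall u v, iota u + iota v * theta = 0 -> u = 0 /\ v = 0
      & #|K| = (#|F| ^ 2)%N].
Proof.
move=> noroot; pose g : {poly F} := 'X^2 + (b%:P * 'X + c%:P).
have sz_aff u v : (size (v%:P * 'X + u%:P : {poly F})%R < 3)%N.
  rewrite size_MXaddC; case: ifP => // _.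
  by rewrite !ltnS (leq_trans (size_polyC_leq1 _)).
have sz_g : size g = 3 by rewrite size_polyDl size_polyXn // sz_aff.
have mon_g : g \is monic.
  by rewrite monicE lead_coefDl ?size_polyXn ?sz_aff // lead_coefXn.
have irr_g : irreducible_poly g.
  apply: cubic_irreducible; rewrite ?sz_g // => t.
  by rewrite /root /g !hornerE; apply: noroot.
have hI : monic_irreducible_poly g by split.
pose K : finFieldType := {poly %/ g with hI}.
pose iota : {rmorphism F -> K} :=
  @GRing.RMorphism.clone F {poly %/ g} (qpolyC g) _.
pose theta : K := in_qpoly g 'X.
have gE : mk_monic g = g by apply: mk_monicE.
have in_qpolyC u : in_qpoly g u%:P = iota u.
  apply: val_inj; apply: in_qpoly_small.
  by rewrite gE sz_g (leq_ltn_trans (size_polyC_leq1 _)).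
have val_comb u v :
    val (iota u + iota v * theta : {poly %/ g}) = v%:P * 'X + u%:P.
  rewrite -!in_qpolyC -(in_qpolyM g) -in_qpolyD addrC.
  by apply: in_qpoly_small; rewrite gE sz_g.
exists K, iota, theta; split.
- have <- : in_qpoly g g = 0.
    by apply: val_inj; rewrite /= gE Pdiv.RingMonic.rmodpp.
  rewrite -!in_qpolyC -(in_qpolyM g) -(rmorphXn (in_qpoly g)) -!(in_qpolyD g).
  by rewrite -addrA.
- move=> y; pose p : {poly F} := val (y : {poly %/ g}).
  exists p`_0, p`_1; apply: val_inj; rewrite val_comb; apply/polyP => i.
  rewrite coefD coefCM coefX coefC -/p.
  case: i => [|[|i]]; rewrite /= ?mulr0 ?mulr1 ?add0r ?addr0 //.
  have szp : (size p < size (mk_monic g))%N by apply: size_mk_monic.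
  by rewrite nth_default // -ltnS (leq_trans szp) // gE sz_g.
- move=> u v /(congr1 (fun z : K => val (z : {poly %/ g}))).
  rewrite val_comb /= => /polyP e; have := e 0%N; have := e 1%N.
  by rewrite !coefE /= !mulr0 !mulr1 ?addr0 ?add0r; split.
by rewrite card_qfpoly sz_g.
Qed.

(** * Zeros of the cubic form phi(P,P,P) *)

Section CubicZeros.

Variables (F : finFieldType) (s : {ffun 'I_4 -> F}).
Implicit Types (P Q R : option F) (t : F).
Local Notation L := (functional s).
Local Notation phi := (trilinear s).
Hypothesis chord_avoids : forall P Q, Q != P -> ~~ on_line s P Q.

(** Otherwise both [P] and [Q] would be zeros of [phi P Q], which has only one. *)
Lemma tangent_unique P Q : on_line s P P -> on_line s Q Q -> P = Q.
Proof.
move=> tP tQ; apply/eqP/negPn/negP => nPQ; case/eqP: (nPQ).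
have nPQl : ~~ on_line s P Q by apply: chord_avoids; rewrite eq_sym.
apply: (trilinear0_unique nPQl).
  by rewrite trilinearAC on_line_trilinear0.
by rewrite trilinearCA trilinearAC on_line_trilinear0.
Qed.

Lemma cubic_form P :
  phi P P P = if P is Some t
    then L 'X^3 - 3%:R * t * L 'X^2 + 3%:R * t ^+ 2 * L 'X - t ^+ 3 * L 1
    else L 1.
Proof.
case: P => [t|]; rewrite /trilinear /=; last by rewrite !mulr1.
have -> : ('X - t%:P) * ('X - t%:P) * ('X - t%:P) =
    'X^3 + ((- (3%:R * t))%:P * 'X^2
    + ((3%:R * t ^+ 2)%:P * 'X + (- t ^+ 3)%:P * 1)) by ring.
by rewrite !functionalD !functionalCM; ring.
Qed.

Lemma tangentE P : on_line s P P =
  if P is Some t then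
    (L 'X^2 - 2%:R * t * L 'X + t ^+ 2 * L 1 == 0) &&
    (L 'X^3 - 2%:R * t * L 'X^2 + t ^+ 2 * L 'X == 0)
  else (L 1 == 0) && (L 'X == 0).
Proof.
case: P => [t|]; rewrite /on_line /=; last by rewrite mulr1 mul1r.
have -> : ('X - t%:P) * ('X - t%:P) = 'X^2 + ((- (2%:R * t))%:P * 'X
    + (t ^+ 2)%:P * 1) by ring.
have -> : ('X^2 + ((- (2%:R * t))%:P * 'X + (t ^+ 2)%:P * 1)) * 'X =
    'X^3 + ((- (2%:R * t))%:P * 'X^2 + (t ^+ 2)%:P * 'X) by ring.
by rewrite !functionalD !functionalCM !addrA !mulNr.
Qed.

Lemma chordE t u : on_line s (Some t) (Some u) =
  (L 'X^2 - (t + u) * L 'X + t * u * L 1 == 0) &&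
  (L 'X^3 - (t + u) * L 'X^2 + t * u * L 'X == 0).
Proof.
rewrite /on_line /=.
have -> : ('X - t%:P) * ('X - u%:P) = 'X^2 + ((- (t + u))%:P * 'X
    + (t * u)%:P * 1) by ring.
have -> : ('X^2 + ((- (t + u))%:P * 'X + (t * u)%:P * 1)) * 'X =
    'X^3 + ((- (t + u))%:P * 'X^2 + (t * u)%:P * 'X) by ring.
by rewrite !functionalD !functionalCM !addrA !mulNr.
Qed.

Lemma chord_infE t : on_line s (Some t) None =
  (L 'X - t * L 1 == 0) && (L 'X^2 - t * L 'X == 0).
Proof.
rewrite /on_line /= mulr1.
have -> : ('X - t%:P) * 'X = 'X^2 + (- t)%:P * 'X by ring.
have -> : 'X - t%:P = 'X + (- t)%:P * 1 by ring.
by rewrite !functionalD !functionalCM !mulNr.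
Qed.

(** The cubic form is the squared linear form of [P0] times a linear cofactor, described by [u] and
    [v]. If [v] were 0, [s] would lie on a chord through [P0]. *)
Lemma tangent_cubic_form P0 : on_line s P0 P0 ->
  exists u v : F, [/\ v != 0 &
    forall P, P != P0 -> (phi P P P == 0) =
      match P0, P with
      | None, None => false
      | None, Some t => u == 3%:R * t * v
      | Some a, None => u == 0
      | Some a, Some t => (t - a) * u == 3%:R * v
      end].
Proof.
rewrite tangentE; case: P0 => [a|] /andP[/eqP L1 /eqP L2]; last first.
  have v0 : L 'X^2 != 0.
    have /chord_avoids : None != Some 0 :> option F by [].
    by rewrite chord_infE L2 L1 !mul0r !subr0 eqxx.
  exists (L 'X^3), (L 'X^2); split=> // -[t|] // _.
  by rewrite cubic_form L1 L2 !mulr0 addr0 subr0 subr_eq0.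
exists (L 1), (L 'X - a * L 1); split=> [|[t|] nP].
- have /chord_avoids : None != Some a :> option F by [].
  rewrite chord_infE; apply: contra => /eqP e; rewrite e eqxx /=.
  have -> : L 'X^2 - a * L 'X = (L 'X^2 - 2%:R * a * L 'X + a ^+ 2 * L 1)
     + a * (L 'X - a * L 1) by ring.
  by rewrite L1 e mulr0 addr0.
- have ta : t - a != 0 by rewrite subr_eq0; apply: contraNneq nP => ->.
  rewrite cubic_form.
  have -> : L 'X^3 - 3%:R * t * L 'X^2 + 3%:R * t ^+ 2 * L 'X - t ^+ 3 * L 1 =
     (L 'X^3 - 2%:R * a * L 'X^2 + a ^+ 2 * L 'X)
     + (2%:R * a - 3%:R * t) * (L 'X^2 - 2%:R * a * L 'X + a ^+ 2 * L 1)
     - (t - a) ^+ 2 * ((t - a) * L 1 - 3%:R * (L 'X - a * L 1)) by ring.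
  rewrite L1 L2 mulr0 addr0 sub0r oppr_eq0 mulf_eq0 expf_eq0 (negPf ta) /=.
  by rewrite subr_eq0.
by rewrite cubic_form.
Qed.

(** As 3 v is nonzero, the linear cofactor does not vanish at [P0], so its one zero lies
    elsewhere. *)
Lemma tangent_cubic_zero P0 : 3%:R != 0 :> F -> on_line s P0 P0 ->
  exists2 R, R != P0 & forall P, P != P0 -> (phi P P P == 0) = (P == R).
Proof.
move=> n3 /tangent_cubic_form[u [v [v0 E]]]; case: P0 E => [a|] E; last first.
  exists (Some (u / (3%:R * v))) => // -[t|] nP; rewrite E //.
  have nv : 3%:R * v != 0 by rewrite mulf_neq0.
  rewrite mulrAC; apply/eqP/eqP => [->|[->]].
    by rewrite [_ * t]mulrC mulfK.
  by rewrite mulrC divfK.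
have [u0|u0] := eqVneq u 0.
  exists None => // -[t|] nP; rewrite E // u0 ?eqxx // mulr0 eq_sym mulf_eq0.
  by rewrite (negPf n3) (negPf v0).
exists (Some (a + 3%:R * v / u)).
  apply/eqP => -[/eqP]; rewrite -subr_eq0 addrAC subrr add0r mulf_eq0 invr_eq0.
  by rewrite (negPf u0) orbF mulf_eq0 (negPf n3) (negPf v0).
move=> [t|] nP; rewrite E // ?(negPf u0) //; apply/eqP/eqP => [<-|[->]].
  by rewrite mulfK // addrC subrK.
by rewrite addrAC subrr add0r divfK.
Qed.

(** Here the cofactor is a multiple, possibly zero, of the linear form of [P0]. *)
Lemma tangent_cubic_char3 P0 : 3%:R = 0 :> F -> on_line s P0 P0 ->
  exists b, forall P, P != P0 -> (phi P P P == 0) = b.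
Proof.
move=> e3 /tangent_cubic_form[u [v [v0 E]]]; exists (u == 0) => P nP.
rewrite E //; case: P0 P nP {E} => [a|] [t|] //= nP; rewrite e3 ?mul0r //.
rewrite mulf_eq0 subr_eq0 (_ : (t == a) = false) //.
by apply: contraNF nP => /eqP ->.
Qed.

Hypothesis no_tangent : forall P, ~~ on_line s P P.

Lemma cubic_zero_char3 : 3%:R = 0 :> F ->
  exists R, forall P, (phi P P P == 0) = (P == R).
Proof.
move=> e3; have cubE P : phi P P P =
    if P is Some t then L 'X^3 - t ^+ 3 * L 1 else L 1.
  by rewrite cubic_form; case: P => // t; rewrite e3; ring.
have e2 : 2%:R = -1 :> F by apply/eqP; rewrite -subr_eq0 opprK natr1 e3.
have [L10|L10] := eqVneq (L 1) 0.
  have L30 : L 'X^3 != 0.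
    apply/eqP => L30; have := no_tangent None.
    rewrite tangentE L10 eqxx /= => LX0.
    (* With [L 1 = L 'X^3 = 0] and 2 = -1, both tangency conditions at t contain the factor
       [L 'X^2 + t * L 'X]. *)
    have /negP[] := no_tangent (Some (- L 'X^2 / L 'X)).
    rewrite tangentE L10 L30 e2; apply/andP; split; apply/eqP; by field.
  exists None => -[t|]; rewrite cubE L10 ?eqxx // mulr0 subr0.
  exact: negPf.
have inj3 : injective (fun t : F => t ^+ 3).
  move=> t u /= e; apply/eqP; rewrite -subr_eq0 -[_ == 0](expf_eq0 _ 3).
  have -> : (t - u) ^+ 3 = t ^+ 3 - u ^+ 3 - 3%:R * t * u * (t - u) by ring.
  by rewrite e e3 subrr !mul0r subrr.
exists (Some (invF inj3 (L 'X^3 / L 1))) => -[t|]; rewrite cubE ?(negPf L10) //.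
rewrite subr_eq0; apply/eqP/eqP => [->|[->]].
  by rewrite mulfK // (invF_f inj3).
by rewrite (f_invF inj3) divfK.
Qed.

(** Cramer's rule, with determinant D up to sign, gives g = X^2 + b X + c such that L kills g and g
    X. If D = 0, [s] is on a line through infinity; if g has a root t, [s] is on the line joining t
    to the second root - b - t. *)
Lemma recurrence : exists b c : F,
  [/\ L 'X^2 = - b * L 'X - c * L 1, L 'X^3 = - b * L 'X^2 - c * L 'X
    & forall t, t ^+ 2 + b * t + c != 0].
Proof.
have no_line P Q : ~~ on_line s P Q.
  by have [->|] := eqVneq Q P; [apply: no_tangent | apply: chord_avoids].
pose D := L 1 * L 'X^2 - L 'X ^+ 2.
have D0 : D != 0.
  apply/eqP => D0; have [L10|L10] := eqVneq (L 1) 0.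
    have := no_tangent None; rewrite tangentE L10 eqxx /=.
    by move/eqP: D0; rewrite /D L10 mul0r sub0r oppr_eq0 expf_eq0 /= => ->.
  have /negP[] := no_line (Some (L 'X / L 1)) None.
  rewrite chord_infE divfK // subrr eqxx /=.
  have -> : L 'X^2 - L 'X / L 1 * L 'X = D / L 1 by rewrite /D; field.
  by rewrite D0 mul0r.
pose b := (L 'X * L 'X^2 - L 1 * L 'X^3) / D.
pose c := (L 'X * L 'X^3 - L 'X^2 ^+ 2) / D.
have e2 : L 'X^2 = - b * L 'X - c * L 1 by rewrite /b /c /D; field.
have e3 : L 'X^3 = - b * L 'X^2 - c * L 'X by rewrite /b /c /D; field.
exists b, c; split=> // t; apply/eqP => t0.
have /negP[] := no_line (Some t) (Some (- b - t)).
rewrite chordE e3 {1}e2.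
have -> : c = - (t ^+ 2 + b * t) by apply/eqP; rewrite -addr_eq0 addrC t0.
by apply/andP; split; apply/eqP; ring.
Qed.

Lemma cubic_zeros :
    (#|F| %% 3 = 1)%N \/ (#|F| %% 3 = 2)%N ->
  let Z := [set P | phi P P P == 0] in
  if (#|F| %% 3 == 1)%N then #|Z| = 1%N else #|Z| = 0%N \/ #|Z| = 3%N.
Proof.
move=> q12 Z; have [b [c [e2 e3 noroot]]] := recurrence.
have [K [iota [theta [th2 gen free cardK]]]] := quadratic_extension noroot.
(* By the recurrence L descends to the functional 1 |-> [L 1], theta |-> [L 'X] on K, whose kernel
   is F d. So phi(P,P,P) = 0 means that the cube of [line_point P] is in F d. *)
pose d := iota (L 'X) - iota (L 1) * theta.
have d0 : d != 0.
  apply/eqP => d0; have [|LX L1] := free (L 'X) (- L 1).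
    by rewrite rmorphN mulNr.
  have := no_tangent None; rewrite tangentE LX.
  by move/eqP: L1; rewrite oppr_eq0 => ->; rewrite eqxx.
have on_d u v : (exists k, iota u + iota v * theta = iota k * d) <->
    u * L 1 + v * L 'X = 0.
  split=> [[k e]|e].
    have [|/subr0_eq -> /eqP] := free (u - k * L 'X) (v + k * L 1).
      rewrite !(rmorphB, rmorphD, rmorphM) -[RHS](subrr (iota k * d)) -{1}e /d.
      ring.
    by rewrite addr_eq0 => /eqP ->; ring.
  have [L10|L10] := eqVneq (L 1) 0.
    have LX0 : L 'X != 0 by have := no_tangent None; rewrite tangentE L10 eqxx.
    exists (u / L 'X); rewrite /d L10 rmorph0 mul0r subr0 -rmorphM divfK //.
    move/eqP: e; rewrite L10 mulr0 add0r mulf_eq0 (negPf LX0) orbF => /eqP ->.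
    by rewrite rmorph0 mul0r addr0.
  exists (- v / L 1); rewrite /d mulrBr mulrA -!rmorphM divfK //.
  have -> : u = - v / L 1 * L 'X.
    apply: (mulIf L10); rewrite mulrAC divfK // mulNr.
    by apply/eqP; rewrite -addr_eq0 e.
  by rewrite [iota (- v)]rmorphN [- iota v * _]mulNr opprK.
have ZE P : P \in Z <-> cube_on iota theta d P.
  rewrite inE /cube_on.
  have [u [v [eP ephi]]] : exists u v,
      line_point iota theta P ^+ 3 = iota u + iota v * theta /\
      phi P P P = u * L 1 + v * L 'X.
    rewrite cubic_form; case: P => [t|] /=; last first.
      by exists 1, 0; rewrite rmorph1 rmorph0 expr1n !mul0r !addr0 mul1r.
    (* The coordinates of (theta - t)^3 reduced by theta^2 = - b theta - c. *)
    exists (b * c + 3%:R * t * c - t ^+ 3).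
    exists (b ^+ 2 - c + 3%:R * t * b + 3%:R * t ^+ 2).
    split; last by rewrite e3 e2; ring.
    apply/subr0_eq; transitivity ((theta ^+ 2 + iota b * theta + iota c)
      * (theta - iota b - 3%:R * iota t)); last by rewrite th2 mul0r.
    ring.
  by rewrite eP on_d ephi; split=> /eqP.
case: eqP => [q1|nq1].
  have [P0 E] := cube_on_unique gen free cardK d0 q1.
  apply/eqP/cards1P; exists P0; apply/setP => P; rewrite [RHS]inE.
  by apply/idP/eqP => [/ZE/E|/E/ZE].
have {q12} q2 : (#|F| %% 3 = 2)%N by case: q12.
have [->|/set0Pn[P0 /ZE ZP0]] := eqVneq Z set0; first by left; rewrite cards0.
have [P1 [P2 [U E]]] := cube_on_three gen free cardK d0 q2 ZP0.
right; rewrite -[3%N]/(size [:: P0; P1; P2]) -(card_uniqP U).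
apply: eq_card => P.
by apply/idP/idP => [/ZE/E|/E/ZE].
Qed.

End CubicZeros.

(** * The possible values of B_3 *)

Section WeightThree.

Variables (F : finFieldType) (s : {ffun 'I_4 -> F}).
Local Notation V := (coset_of_syndrome s).
Local Notation phi := (trilinear s).
Local Notation q := #|F|.
Hypothesis F_gt4 : (4 < q)%N.
Hypothesis V_min3 : forall x, x \in V -> (3 <= hwt x)%N.

Lemma Bw3_rat (N : rat) : (\sum_P tangent_count s P)%:R = N ->
  (Bw V 3)%:R = (q%:R ^+ 2 + q%:R - 2 * N) / 6 :> rat.
Proof.
move=> <-; have /(congr1 (fun n => n%:R : rat)) := Bw3_tangents F_gt4 V_min3.
rewrite natrD !natrM -[q.+1%:R]natr1 => e.
have -> : q%:R ^+ 2 + q%:R = (q%:R + 1) * q%:R :> rat by ring.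
by rewrite -e; field.
Qed.

(** [P0] contributes q; the other q points have no tangent through [s] and contribute 1 each, except
    the r zeros of the cubic form. *)
Lemma sum_tangent_count_tangent P0 (r : nat) : on_line s P0 P0 ->
    #|[set P | (P != P0) && (phi P P P == 0)]| = r ->
  (\sum_P tangent_count s P + r = q.*2)%N.
Proof.
move=> tP0 <-; rewrite (bigD1 P0) //= {1}/tangent_count tP0 -addnA -addnn.
congr (_ + _)%N; rewrite -sum1_card big_mkcond [X in (_ + X)%N]big_mkcond.
rewrite -big_split /=.
transitivity (\sum_(P | P != P0) 1)%N; last first.
  by rewrite sum1_card (eq_card (B := mem (predC1 P0))) // cardC1 card_option.
rewrite [RHS]big_mkcond; apply: eq_bigr => P _; rewrite inE.
case: eqVneq => //= nP; rewrite /tangent_count ifN; first by case: (_ == _).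
apply: contraNN nP => tP.
by rewrite (tangent_unique (chord_avoids F_gt4 V_min3) tP tP0).
Qed.

Lemma sum_tangent_count_notangent : (forall P, ~~ on_line s P P) ->
  (\sum_P tangent_count s P + #|[set P | phi P P P == 0%R]| = q.+1)%N.
Proof.
move=> nt; rewrite -sum1_card [X in (_ + X)%N]big_mkcond -big_split /=.
rewrite -card_option -sum1_card; apply: eq_bigr => P _; rewrite inE.
by rewrite /tangent_count (negPf (nt P)); case: (_ == _).
Qed.

(** Let N be the sum of [tangent_count]. With a tangent through [s], N = 2 q - 1 if 3 does not
    divide q, and N is q or 2 q otherwise. Without one, N = q + 1 - r, where r is 0 or 3 if q = 2
    mod 3 and r = 1 otherwise. *)
Lemma Bw3_values (Q := q%:R : rat) (B3 := (Bw V 3)%:R : rat) :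
  if (q %% 3 == 1)%N then
    (B3 = (Q ^+ 2 - 3 * Q + 2) / 6 \/ B3 = (Q ^+ 2 - Q) / 6)
  else if (q %% 3 == 2)%N then
    (B3 = (Q ^+ 2 - 3 * Q + 2) / 6 \/ B3 = (Q ^+ 2 - Q - 2) / 6
       \/ B3 = (Q ^+ 2 - Q + 4) / 6)
  else (B3 = (Q ^+ 2 - 3 * Q) / 6 \/ B3 = (Q ^+ 2 - Q) / 6).
Proof.
have chords := chord_avoids F_gt4 V_min3.
have sumE r m : (\sum_P tangent_count s P + r = m)%N ->
    B3 = (Q ^+ 2 + Q - 2 * (m%:R - r%:R)) / 6.
  by move=> <-; apply: Bw3_rat; rewrite natrD addrK.
have n3 : ~~ (3 %| q)%N -> 3%:R != 0 :> F by rewrite -natr3_eq0.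
have [/existsP[P0 tP0]|nt] := boolP [exists P, on_line s P P].
  have tE r h := sumE _ _ (@sum_tangent_count_tangent P0 r tP0 h).
  have ch : ~~ (3 %| q)%N -> B3 = (Q ^+ 2 - 3 * Q + 2) / 6.
    move=> /n3/(tangent_cubic_zero chords)/(_ tP0)[R nR E].
    rewrite (tE 1%N) -?muln2 ?natrM; first by rewrite -/Q; field.
    apply/eqP/cards1P; exists R; apply/setP => P; rewrite !inE.
    have [->|nP] := eqVneq P P0; last by rewrite E.
    by rewrite /= (eq_sym P0) (negPf nR).
  case: eqP => q1; first by left; apply: ch; lia.
  case: eqP => q2; first by left; apply: ch; lia.
  have /eqP F3 : 3%:R == 0 :> F by rewrite natr3_eq0; lia.
  have [[] E] := tangent_cubic_char3 chords F3 tP0.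
    right; rewrite (tE q) -?muln2 ?natrM; first by rewrite -/Q; field.
    rewrite -[RHS]/(q.+1.-1) -card_option -(cardC1 P0); apply: eq_card => P.
    by rewrite !inE; case: eqVneq => // nP; rewrite E.
  left; rewrite (tE 0%N) -?muln2 ?natrM; first by rewrite -/Q; field.
  apply/eqP; rewrite cards_eq0; apply/eqP/setP => P; rewrite !inE.
  by case: eqVneq => // nP; rewrite E.
have {}nt P : ~~ on_line s P P by move: nt; rewrite negb_exists => /forallP.
have nE r (rE : #|[set P | phi P P P == 0]| = r) :
    B3 = (Q ^+ 2 - Q - 2 + 2 * r%:R) / 6.
  rewrite (sumE _ _ (sum_tangent_count_notangent nt)) rE -[q.+1%:R]natr1 -/Q.
  by congr (_ / _); ring.
have zeros := cubic_zeros chords nt.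
case: eqP zeros => q1 zeros.
  right; rewrite (nE 1%N); first by congr (_ / _); ring.
  by apply: zeros; left.
case: eqP => q2.
  have [z|z] := zeros (or_intror q2); right; [left|right].
    by rewrite (nE _ z); congr (_ / _); ring.
  by rewrite (nE _ z); congr (_ / _); ring.
have /eqP F3 : 3%:R == 0 :> F by rewrite natr3_eq0; lia.
have [R E] := cubic_zero_char3 nt F3.
right; rewrite (nE 1%N); first by congr (_ / _); ring.
by apply/eqP/cards1P; exists R; apply/setP => P; rewrite !inE E.
Qed.

End WeightThree.

Theorem theorem4p4 (F : finFieldType) (V : {set vec F}) :
  (5 <= #|F|)%N ->
  is_coset V -> coset_weight_is V 3 ->
  let q : rat := (#|F|)%:R in
  let B3 : rat := (Bw V 3)%:R in
  [/\ [/\ Bw V 0 = 0%N, Bw V 1 = 0%N & Bw V 2 = 0%N],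
      (if (#|F| %% 3 == 1)%N then
         (B3 = (q ^+ 2 - 3 * q + 2) / 6 \/ B3 = (q ^+ 2 - q) / 6)
       else if (#|F| %% 3 == 2)%N then
         (B3 = (q ^+ 2 - 3 * q + 2) / 6 \/ B3 = (q ^+ 2 - q - 2) / 6
           \/ B3 = (q ^+ 2 - q + 4) / 6)
       else
         (B3 = (q ^+ 2 - 3 * q) / 6 \/ B3 = (q ^+ 2 - q) / 6)),
      (Bw V 4)%:R = ('C(#|F|.+1, 4))%:R - (q - 2) * B3
    & forall w : nat, (5 <= w)%N ->
      (Bw V w)%:R = (Aw F w)%:R + (-1) ^+ w *
        (('C(#|F|.+1, w) * 'C(w.-1, 3))%:R - ('C(#|F| - 2, w - 3))%:R * B3)].
Proof.
move=> F_gt4 /is_cosetE[s ->] [_ V_min3] q B3; split.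
- by split; apply: Bw_small.
- exact: Bw3_values.
(* The general formula at w = 4, where the code has no words. *)
- rewrite (Bw_ge4 F_gt4 V_min3) // Aw4 // add0r bin1 muln1.
  by rewrite -signr_odd mul1r natrB //; apply: leq_trans F_gt4.
by move=> w w5; apply: Bw_ge4 => //; apply: ltnW.
Qed.
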